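(* Let $z_1,\dots,z_n$ be pairwise distinct complex numbers, let $\Lambda_1,\dots,\Lambda_n\in\mathfrak h^*$ be weights of $\mathfrak{sl}_3$, let $l_1,l_2$ be nonnegative integers, and let $t^{(1)}_1,\dots,t^{(1)}_{l_1},t^{(2)}_1,\dots,t^{(2)}_{l_2}$ be complex numbers. Put $$P_1(x)=\prod_{i=1}^{l_1}(t^{(1)}_i-x),\qquad P_2(x)=\prod_{i=1}^{l_2}(t^{(2)}_i-x).$$ Assume that the roots $t^{(1)}_1,\dots,t^{(1)}_{l_1},t^{(2)}_1,\dots,t^{(2)}_{l_2}$ of $P_1,P_2$ are all pairwise distinct, and that $z_s\notin\{t^{(i)}_1,\dots,t^{(i)}_{l_i}\}$ for all $s=1,\dots,n$ and $i=1,2$. Then the roots of $P_1,P_2$ form a solution to the system ($\mathfrak{sl}_3$ Bethe ansatz equations) $$\sum_{s=1}^{n}\frac{(\Lambda_s,\alpha_1)}{t_i^{(1)}-z_s}-\sum_{j=1,\,j\neq i}^{l_1}\frac{2}{t_i^{(1)}-t_j^{(1)}}+\sum_{j=1}^{l_2}\frac{1}{t_i^{(1)}-t_j^{(2)}}=0,\qquad i=1,\dots,l_1,$$ $$\sum_{s=1}^{n}\frac{(\Lambda_s,\alpha_2)}{t_i^{(2)}-z_s}-\sum_{j=1,\,j\neq i}^{l_2}\frac{2}{t_i^{(2)}-t_j^{(2)}}+\sum_{j=1}^{l_1}\frac{1}{t_i^{(2)}-t_j^{(1)}}=0,\qquad i=1,\dots,l_2,$$ if and only if there exist complex numbers $\mu_1,\dots,\mu_n$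 with $\mu_1+\dots+\mu_n=0$ such that $$P_1''P_2-P_1'P_2'+P_1P_2''-P_1'P_2\sum_{s=1}^n\frac{(\Lambda_s,\alpha_1)}{x-z_s}-P_1P_2'\sum_{s=1}^n\frac{(\Lambda_s,\alpha_2)}{x-z_s}+P_1P_2\sum_{s=1}^n\frac{1}{x-z_s}\Bigl(\mu_s-\sum_{k\neq s}\frac{(\Lambda_s,\Lambda_k)}{z_s-z_k}\Bigr)=0$$ identically in $x$.
   Context: $\mathfrak h$ is the Cartan subalgebra of $\mathfrak{sl}_3$ of diagonal matrices, $\alpha_1,\alpha_2\in\mathfrak h^*$ are the simple roots, and $(\cdot,\cdot)$ is the invariant scalar product on $\mathfrak{sl}_3$ (and the induced one on $\mathfrak h^*$) normalized by $(h_i,h_i)=2$, where $h_i=e_{i,i}-e_{i+1,i+1}$. Primes denote derivatives with respect to $x$. *)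

(* Defs.v *)
From mathcomp Require Import all_boot all_order all_algebra.
From mathcomp Require Import complex.
From mathcomp Require Import reals.

Set Implicit Arguments.
Unset Strict Implicit.
Unset Printing Implicit Defensive.

Import GRing.Theory.

Local Open Scope ring_scope.

(* The field of complex numbers is R[i] for R : realType. Indices of simple
   roots are shifted by one: 0, 1 : 'I_2 stand for 1, 2. *)

Section Sl3.
Variable R : realType.
Local Notation C := R[i].

Definition lie_bracket (x y : 'M[C]_3) : 'M[C]_3 := x *m y - y *m x.

Definition sl3 : {vspace 'M[C]_3} :=
  lker (linfun (mxtrace : 'M[C]_3 -> C^o)).

Definition cartan : {vspace 'M[C]_3} :=
  (sl3 :&: limg (linfun (@diag_mx C 3)))%VS.

Definition coroot (i : 'I_2) : 'M[C]_3 :=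
  delta_mx (inord i) (inord i) - delta_mx (inord i.+1) (inord i.+1).

Definition weight := 'Hom(subvs_of cartan, C^o).

Definition simple_root (i : 'I_2) : weight :=
  linfun (fun h : subvs_of cartan =>
    (vsval h (inord i) (inord i) - vsval h (inord i.+1) (inord i.+1) : C^o)).

(* Only the values of B on sl3 matter. Nondegeneracy of B follows from the
   conditions because sl3 is simple, and they determine B on sl3. *)
Definition normalized_invariant_form (B : 'M[C]_3 -> 'M[C]_3 -> C) : Prop :=
  [/\ {in sl3 & sl3 & sl3, forall x y z, forall a : C,
         B (a *: x + y) z = a * B x z + B y z},
      {in sl3 &, forall x y, B x y = B y x},
      {in sl3 & sl3 & sl3, forall x y z,
         B (lie_bracket x y) z = B x (lie_bracket y z)}
    & forall i : 'I_2, B (coroot i) (coroot i) = 2].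

Lemma normalized_invariant_form_trace :
  normalized_invariant_form (fun x y : 'M[C]_3 => \tr (x *m y)).
Proof.
split.
- by move=> x y z _ _ _ a; rewrite mulmxDl -scalemxAl raddfD /= mxtraceZ.
- by move=> x y _ _; rewrite mxtrace_mulC.
- move=> x y z _ _ _; rewrite /lie_bracket mulmxBl mulmxBr !raddfB /= !mulmxA.
  by congr (_ - _); rewrite [RHS]mxtrace_mulC mulmxA.
- move=> i; set a := inord i : 'I_3; set b := inord i.+1 : 'I_3.
  have ab : a != b.
    by apply/eqP => /(congr1 val) /=; rewrite !inordK //; case: i {a b} => [[|[]]].
  rewrite /coroot -/a -/b mulmxBl !mulmxBr !mul_delta_mx.
  rewrite mul_delta_mx_0 // mul_delta_mx_0 1?eq_sym //.
  have tr1 (c : 'I_3) : \tr (delta_mx c c : 'M[C]_3) = 1.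
    rewrite /mxtrace (bigD1 c) //= big1 ?addr0 ?mxE ?eqxx //= => j jc.
    by rewrite mxE (negbTE jc).
  by rewrite subr0 sub0r opprK raddfD /= !tr1.
Qed.

Definition form_to_dual (B : 'M[C]_3 -> 'M[C]_3 -> C) :
    'Hom(subvs_of cartan, weight) :=
  linfun (fun h : subvs_of cartan =>
    (linfun (fun k : subvs_of cartan => (B (vsval h) (vsval k) : C^o))
     : weight)).

(* The form on the dual of the Cartan subalgebra obtained by transport along
   form_to_dual B; the latter is invertible for B as above. *)
Definition dual_form (B : 'M[C]_3 -> 'M[C]_3 -> C) (la mu : weight) : C :=
  let nu := ((form_to_dual B)^-1)%VF in B (vsval (nu la)) (vsval (nu mu)).

Definition root_poly (l : nat) (t : 'I_l -> C) : {poly C} :=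
  \prod_(i < l) ((t i)%:P - 'X).

End Sl3.

Arguments simple_root {R} i.

(* Main.v *)
Require Import Defs.
From mathcomp Require Import all_boot all_order all_algebra.
From mathcomp Require Import complex.
From mathcomp Require Import reals.
From mathcomp Require Import ring.

(** Dividing the differential expression by [P1 P2] and expanding in partial
    fractions, its residues at the [t]'s are minus the left-hand sides of the
    Bethe ansatz equations, while those at the [z]'s vanish for exactly one
    choice of [mu].  For that choice the sum of the [mu s] telescopes to zero,
    because the double sums over pairs of roots and over pairs of points [z]
    are antisymmetric.  Conversely, evaluating the expression at a root of
    [P1] or [P2] gives back a Bethe ansatz equation multiplied by a nonzero
    factor.  The form enters only through the symmetry of [dual_form B]. *)

Set Implicit Arguments.
Unset Strict Implicit.
Unset Printing Implicit Defensive.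

Import GRing.Theory Num.Theory.

Local Open Scope ring_scope.

(** * Logarithmic derivatives of root products *)

Section RootProducts.
Variables (F : fieldType) (I : finType) (t : I -> F).
Implicit Types (r : seq I) (P : pred I) (x : F).

Local Notation root_prod r P := (\prod_(i <- r | P i) ((t i)%:P - 'X)).

Lemma horner_root_prod_neq0 r P x : (forall i, P i -> x != t i) ->
  (root_prod r P).[x] != 0.
Proof.
move=> xt; rewrite horner_prod prodf_seq_neq0; apply/allP => i _.
by apply/implyP => /xt; rewrite !hornerE subr_eq0 eq_sym.
Qed.

(** Each factor contributes [-1 / (t i - x) = (x - t i)^-1] to the logarithmic derivative. The
    filter [P] allows one factor to be left out later. *)
Lemma deriv_root_prod r P x : (forall i, P i -> x != t i) ->
  (root_prod r P)^`().[x]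
  = (root_prod r P).[x] * \sum_(i <- r | P i) (x - t i)^-1.
Proof.
move=> xt; elim: r => [|i r IHr]; first by rewrite !big_nil derivE !hornerE.
rewrite !big_cons; case: ifP => // Pi.
have := xt i Pi; rewrite -subr_eq0 => xi.
by rewrite !derivE !hornerE IHr; field.
Qed.

(** This is [f'' / f = (f' / f)^2 + (f' / f)']. *)
Lemma deriv2_root_prod r P x : (forall i, P i -> x != t i) ->
  (root_prod r P)^`()^`().[x]
  = (root_prod r P).[x]
    * ((\sum_(i <- r | P i) (x - t i)^-1) ^+ 2
       - \sum_(i <- r | P i) (x - t i)^-1 ^+ 2).
Proof.
move=> xt; elim: r => [|i r IHr].
  by rewrite !big_nil !derivE !hornerE; ring.
rewrite !big_cons; case: ifP => // Pi.
have := xt i Pi; rewrite -subr_eq0 => xi.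
by rewrite !derivE !hornerE /= IHr deriv_root_prod //; field.
Qed.

Lemma horner_root_prod_root i : (root_prod (index_enum I) predT).[t i] = 0.
Proof. by rewrite (bigD1 i) //= !hornerE subrr mul0r. Qed.

Lemma deriv_root_prod_root i :
  (root_prod (index_enum I) predT)^`().[t i]
  = - (root_prod (index_enum I) (fun j => j != i)).[t i].
Proof. by rewrite (bigD1 i) //= !derivE !hornerE /= subrr; ring. Qed.

(** If [f = (t i - X) q], then at [t i] one has [f' = - q] and [f'' = - 2 q'], so [f'' / f'] is
    twice the logarithmic derivative of [q]. This is the source of the terms [2 / (t i - t j)] in
    the Bethe equations. *)
Lemma deriv2_root_prod_root i : injective t ->
  (root_prod (index_enum I) predT)^`()^`().[t i]
  = (root_prod (index_enum I) predT)^`().[t i]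
    * \sum_(j | j != i) 2 / (t i - t j).
Proof.
move=> t_inj; rewrite deriv_root_prod_root (bigD1 i) //= !derivE !hornerE /=.
rewrite subrr deriv_root_prod => [|j]; last by rewrite (inj_eq t_inj) eq_sym.
by rewrite -mulr_sumr; ring.
Qed.

Lemma deriv_root_prod_root_neq0 i : injective t ->
  (root_prod (index_enum I) predT)^`().[t i] != 0.
Proof.
move=> t_inj; rewrite deriv_root_prod_root oppr_eq0.
by apply: horner_root_prod_neq0 => j; rewrite (inj_eq t_inj) eq_sym.
Qed.

End RootProducts.

(** * Partial fractions of products of sums of simple poles *)

Section PartialFractions.
Variables (F : fieldType) (I J : finType).

(** The poles of the two factors are disjoint, so the residue at a pole of one factor is its
    coefficient there times the value of the other factor. *)
Lemma partial_fractions_mul (u a : I -> F) (v b : J -> F) (x : F) :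
    (forall i, x != a i) -> (forall j, x != b j) ->
    (forall i j, a i != b j) ->
  (\sum_i u i / (x - a i)) * (\sum_j v j / (x - b j))
  = \sum_i (\sum_j v j / (a i - b j)) * u i / (x - a i)
    + \sum_j (\sum_i u i / (b j - a i)) * v j / (x - b j).
Proof.
move=> xa xb ab; rewrite mulr_suml.
have -> : \sum_j (\sum_i u i / (b j - a i)) * v j / (x - b j)
    = \sum_i \sum_j u i / (b j - a i) * v j / (x - b j).
  by rewrite exchange_big; apply: eq_bigr => j _; rewrite -mulrA mulr_suml;
     apply: eq_bigr => i _; rewrite mulrA.
rewrite -big_split; apply: eq_bigr => i _ /=.
rewrite mulr_sumr -mulrA mulr_suml -big_split; apply: eq_bigr => j _ /=.
by field; rewrite !subr_eq0 xa xb ab eq_sym ab.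
Qed.

Lemma partial_fractions_sqr (t : I -> F) (x : F) :
    injective t -> (forall i, x != t i) ->
  (\sum_i (x - t i)^-1) ^+ 2 - \sum_i (x - t i)^-1 ^+ 2
  = \sum_i (\sum_(j | j != i) 2 / (t i - t j)) / (x - t i).
Proof.
move=> t_inj xt.
have -> : (\sum_i (x - t i)^-1) ^+ 2 - \sum_i (x - t i)^-1 ^+ 2
    = \sum_i \sum_(j | j != i) (x - t i)^-1 * (x - t j)^-1.
  rewrite expr2 mulr_suml -sumrB; apply: eq_bigr => i _.
  by rewrite mulr_sumr (bigD1 i) //= expr2 addrAC subrr add0r.
(* The double poles have cancelled. Each cross term splits into two simple fractions; exchanging [i]
   and [j] in the second half makes it equal to the first, whence the factor 2. *)
transitivity (\sum_i \sum_(j | j != i) (t i - t j)^-1 / (x - t i)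
              + \sum_i \sum_(j | j != i) (t j - t i)^-1 / (x - t j)).
  rewrite -big_split; apply: eq_bigr => i _ /=.
  rewrite -big_split; apply: eq_bigr => j ji /=.
  by field; rewrite !subr_eq0 !xt !(inj_eq t_inj) ji eq_sym ji.
rewrite [X in _ + X](exchange_big_dep predT) //= -big_split.
apply: eq_bigr => i _ /=.
rewrite [X in _ + X](eq_bigl (fun j => j != i)) => [|j]; last by rewrite eq_sym.
rewrite mulr_suml -big_split; apply: eq_bigr => j _ /=; ring.
Qed.

End PartialFractions.

(** * Antisymmetric sums and symmetry of the form on weights *)

Lemma sum_antisymmetric (F : numFieldType) (I : finType) (g : I -> I -> F) :
  (forall i j, g i j = - g j i) -> \sum_i \sum_(j | j != i) g i j = 0.
Proof.
move=> gN; set S := LHS; suff /eqP : S = - S.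
  by rewrite -subr_eq0 opprK -mulr2n mulrn_eq0 => /eqP.
rewrite {1}/S (exchange_big_dep predT) //= -sumrN; apply: eq_bigr => i _.
by rewrite -sumrN; apply: eq_big => [j|j _]; [rewrite eq_sym | exact: gN].
Qed.

(** The transported vectors lie in [cartan], hence in [sl3], where [B] is assumed symmetric. *)
Lemma dual_form_sym (R : realType) (B : 'M[R[i]]_3 -> 'M[R[i]]_3 -> R[i]) :
  normalized_invariant_form B ->
  forall la mu, dual_form B la mu = dual_form B mu la.
Proof.
case=> _ Bsym _ _ la mu; apply: Bsym.
all: by apply: subvP (subvsP _); exact: capvSl.
Qed.

(** * The differential expression and its residues *)

Section BetheAnsatz.
Variables (F : numFieldType) (n l1 l2 : nat).
Variables (z a b : 'I_n -> F) (t1 : 'I_l1 -> F) (t2 : 'I_l2 -> F).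
Hypotheses (t1_inj : injective t1) (t2_inj : injective t2).
Hypotheses (t12 : forall i j, t1 i != t2 j).
Hypotheses (zt1 : forall s i, z s != t1 i) (zt2 : forall s i, z s != t2 i).

Let P1 : {poly F} := \prod_i ((t1 i)%:P - 'X).
Let P2 : {poly F} := \prod_i ((t2 i)%:P - 'X).

Let bethe1 i := \sum_s a s / (t1 i - z s)
  - \sum_(j | j != i) 2 / (t1 i - t1 j) + \sum_j 1 / (t1 i - t2 j).
Let bethe2 i := \sum_s b s / (t2 i - z s)
  - \sum_(j | j != i) 2 / (t2 i - t2 j) + \sum_j 1 / (t2 i - t1 j).

(** The coefficients [c] stay free: they do not affect the values at the roots, and away from them
    they enter only the residues at the points [z s]. *)
Definition bethe_operator (c : 'I_n -> F) (x : F) :=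
  P1^`()^`().[x] * P2.[x] - P1^`().[x] * P2^`().[x] + P1.[x] * P2^`()^`().[x]
  - P1^`().[x] * P2.[x] * (\sum_s a s / (x - z s))
  - P1.[x] * P2^`().[x] * (\sum_s b s / (x - z s))
  + P1.[x] * P2.[x] * (\sum_s 1 / (x - z s) * c s).

Let t21 j i : t2 j != t1 i. Proof. by rewrite eq_sym. Qed.

(** At [t1 i] every term with the factor [P1] drops out, and [P1' P2] factors out of the rest. *)
Lemma bethe_operator_root1 c i :
  bethe_operator c (t1 i) = - (P1^`().[t1 i] * P2.[t1 i]) * bethe1 i.
Proof.
rewrite /bethe_operator horner_root_prod_root deriv2_root_prod_root //.
rewrite [P2^`().[_]]deriv_root_prod // /bethe1.
under [X in _ = _ * (_ + X)]eq_bigr do rewrite div1r.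
by rewrite -/P1 -/P2; ring.
Qed.

Lemma bethe_operator_root2 c i :
  bethe_operator c (t2 i) = - (P2^`().[t2 i] * P1.[t2 i]) * bethe2 i.
Proof.
rewrite /bethe_operator horner_root_prod_root deriv2_root_prod_root //.
rewrite [P1^`().[_]]deriv_root_prod // /bethe2.
under [X in _ = _ * (_ + X)]eq_bigr do rewrite div1r.
by rewrite -/P1 -/P2; ring.
Qed.

Lemma bethe_operator_partial_fractions c x :
    (forall s, x != z s) -> (forall i, x != t1 i) -> (forall i, x != t2 i) ->
  bethe_operator c x = P1.[x] * P2.[x]
    * (\sum_s (c s - a s * (\sum_i 1 / (z s - t1 i))
                   - b s * (\sum_i 1 / (z s - t2 i))) / (x - z s)
       - \sum_i bethe1 i / (x - t1 i) - \sum_i bethe2 i / (x - t2 i)).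
Proof.
move=> xz xt1 xt2.
have inv1 (I : finType) (t : I -> F) :
    \sum_i (x - t i)^-1 = \sum_i 1 / (x - t i).
  by apply: eq_bigr => i _; rewrite div1r.
rewrite /bethe_operator [P1^`()^`().[_]]deriv2_root_prod //.
rewrite [P2^`()^`().[_]]deriv2_root_prod // !partial_fractions_sqr //.
rewrite [P1^`().[_]]deriv_root_prod // [P2^`().[_]]deriv_root_prod // !inv1.
rewrite -/P1 -/P2.
have t1z i s : t1 i != z s by rewrite eq_sym.
have t2z i s : t2 i != z s by rewrite eq_sym.
(* These are the three mixed products in the quotient by [P1 P2]: [P1' P2'], and each of [P1'],
   [P2'] with its sum over the [z s]. *)
have S12 := partial_fractions_mul (fun=> 1) (fun=> 1) xt1 xt2 t12.
have S1z := partial_fractions_mul (fun=> 1) a xt1 xz t1z.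
have S2z := partial_fractions_mul (fun=> 1) b xt2 xz t2z.
have distr_z : \sum_s (c s - a s * (\sum_i 1 / (z s - t1 i))
                         - b s * (\sum_i 1 / (z s - t2 i))) / (x - z s)
    = \sum_s 1 / (x - z s) * c s
      - \sum_s (\sum_i 1 / (z s - t1 i)) * a s / (x - z s)
      - \sum_s (\sum_i 1 / (z s - t2 i)) * b s / (x - z s).
  by rewrite -!sumrB; apply: eq_bigr => s _; ring.
have distr1 : \sum_i bethe1 i / (x - t1 i)
    = \sum_i (\sum_s a s / (t1 i - z s)) * 1 / (x - t1 i)
      - \sum_i (\sum_(j | j != i) 2 / (t1 i - t1 j)) / (x - t1 i)
      + \sum_i (\sum_j 1 / (t1 i - t2 j)) * 1 / (x - t1 i).
  rewrite -sumrB -big_split; apply: eq_bigr => i _ /=; rewrite /bethe1; ring.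
have distr2 : \sum_i bethe2 i / (x - t2 i)
    = \sum_i (\sum_s b s / (t2 i - z s)) * 1 / (x - t2 i)
      - \sum_i (\sum_(j | j != i) 2 / (t2 i - t2 j)) / (x - t2 i)
      + \sum_i (\sum_j 1 / (t2 i - t1 j)) * 1 / (x - t2 i).
  rewrite -sumrB -big_split; apply: eq_bigr => i _ /=; rewrite /bethe2; ring.
(* With every sum named as an atom, the identity becomes linear in the three mixed products. [Q1]
   and [Q2] stand for [P1'' / P1] and [P2'' / P2]. *)
rewrite distr_z distr1 distr2; move: S12 S1z S2z.
set S1 := \sum_i 1 / (x - t1 i); set S2 := \sum_i 1 / (x - t2 i).
set A := \sum_s a s / (x - z s); set A' := \sum_s b s / (x - z s).
set X1 := \sum_i _ * 1 / _; set X2 := \sum_i _ * 1 / _.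
set Y1 := \sum_i _ * 1 / _; set Y2 := \sum_i _ * a _ / _.
set Z1 := \sum_i _ * 1 / _; set Z2 := \sum_i _ * b _ / _.
move=> S12 S1z S2z.
set Q1 := \sum_i _; set Q2 := \sum_i _; set K := \sum_s _.
transitivity (P1.[x] * P2.[x] * (Q1 - S1 * S2 + Q2 - S1 * A - S2 * A' + K)).
  by ring.
by rewrite S12 S1z S2z; ring.
Qed.

(** Adding up all Bethe equations cancels the interactions between roots, within each family and
    across the two; only the sums over pairs of a root and a [z s] survive. *)
Lemma sum_bethe_residues :
    (forall i, bethe1 i = 0) -> (forall i, bethe2 i = 0) ->
  \sum_s (a s * (\sum_i 1 / (z s - t1 i)) + b s * (\sum_i 1 / (z s - t2 i)))
  = 0.
Proof.
move=> eq1 eq2.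
have pairN (I : finType) (t : I -> F) :
    \sum_i \sum_(j | j != i) 2 / (t i - t j) = 0.
  by apply: sum_antisymmetric => i j; rewrite -(opprB (t j)) invrN mulrN.
have swap (I : finType) (t : I -> F) (w : 'I_n -> F) :
    \sum_s w s * (\sum_i 1 / (z s - t i))
    = - \sum_i \sum_s w s / (t i - z s).
  rewrite exchange_big -sumrN; apply: eq_bigr => s _ /=.
  rewrite mulr_sumr -sumrN; apply: eq_bigr => i _.
  by rewrite -(opprB (t i)) invrN mul1r mulrN.
have sum1 : \sum_i bethe1 i = 0 by rewrite big1.
have sum2 : \sum_i bethe2 i = 0 by rewrite big1.
move: sum1 sum2; rewrite !big_split /= !sumrN !pairN !subr0 !swap.
have -> : \sum_i \sum_j 1 / (t2 i - t1 j) = - \sum_i \sum_j 1 / (t1 i - t2 j).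
  rewrite exchange_big -sumrN; apply: eq_bigr => i _ /=.
  by rewrite -sumrN; apply: eq_bigr => j _; rewrite -(opprB (t1 i)) invrN mulrN.
move=> /eqP; rewrite addr_eq0 => /eqP -> /eqP; rewrite subr_eq0 => /eqP ->.
by rewrite opprK subrr.
Qed.

Lemma bethe_iff_operator (g : 'I_n -> 'I_n -> F) :
    (forall s k, g s k = g k s) ->
  (forall i, bethe1 i = 0) /\ (forall i, bethe2 i = 0)
  <-> exists mu : 'I_n -> F, \sum_s mu s = 0 /\
      forall x, (forall s, x <> z s) ->
        bethe_operator
          (fun s => mu s - \sum_(k | k != s) g s k / (z s - z k)) x = 0.
Proof.
move=> g_sym; split=> [[eq1 eq2]|[mu [_ op0]]]; last first.
  split=> i.
  - have /op0/eqP : forall s, t1 i <> z s.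
      by move=> s /esym/eqP; rewrite (negbTE (zt1 s i)).
    rewrite bethe_operator_root1 mulf_eq0 oppr_eq0 mulf_eq0.
    rewrite (negbTE (deriv_root_prod_root_neq0 _ _)) //.
    by rewrite (negbTE (horner_root_prod_neq0 _ _)) // => /eqP.
  - have /op0/eqP : forall s, t2 i <> z s.
      by move=> s /esym/eqP; rewrite (negbTE (zt2 s i)).
    rewrite bethe_operator_root2 mulf_eq0 oppr_eq0 mulf_eq0.
    rewrite (negbTE (deriv_root_prod_root_neq0 _ _)) //.
    by rewrite (negbTE (horner_root_prod_neq0 _ _)) // => /eqP.
(* The first two terms make the residue at [z s] vanish; the last one compensates the sum subtracted
   from [mu s]. *)
exists (fun s => a s * (\sum_i 1 / (z s - t1 i))
  + b s * (\sum_i 1 / (z s - t2 i)) + \sum_(k | k != s) g s k / (z s - z k)).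
split=> [|x /(_ _)/eqP xz].
  rewrite big_split /= sum_bethe_residues // add0r; apply: sum_antisymmetric.
  by move=> s k; rewrite g_sym -(opprB (z k)) invrN mulrN.
(* The partial fraction expansion excludes the roots, so these values of [x] are settled directly by
   the Bethe equations. *)
have [/existsP[i /eqP ->]|] := boolP [exists i, x == t1 i].
  by rewrite bethe_operator_root1 eq1 mulr0.
rewrite negb_exists => /forallP xt1.
have [/existsP[i /eqP ->]|] := boolP [exists i, x == t2 i].
  by rewrite bethe_operator_root2 eq2 mulr0.
rewrite negb_exists => /forallP xt2.
rewrite bethe_operator_partial_fractions // !big1 ?subrr ?mulr0 // => i _.
- by rewrite eq2 mul0r.
- by rewrite eq1 mul0r.
- by ring.
Qed.

End BetheAnsatz.

Theorem theorem4p2p3 (R : realType)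
    (B : 'M[R[i]]_3 -> 'M[R[i]]_3 -> R[i])
    (hB : normalized_invariant_form B)
    (n : nat) (z : 'I_n -> R[i]) (z_inj : injective z)
    (La : 'I_n -> weight R)
    (l1 l2 : nat) (t1 : 'I_l1 -> R[i]) (t2 : 'I_l2 -> R[i])
    (t1_inj : injective t1) (t2_inj : injective t2)
    (t1_t2 : forall i j, t1 i <> t2 j)
    (z_t1 : forall s i, z s <> t1 i) (z_t2 : forall s i, z s <> t2 i) :
  let P1 := root_poly t1 in
  let P2 := root_poly t2 in
  ((forall i : 'I_l1,
      \sum_(s < n) dual_form B (La s) (simple_root 0) / (t1 i - z s)
      - \sum_(j < l1 | j != i) 2 / (t1 i - t1 j)
      + \sum_(j < l2) 1 / (t1 i - t2 j) = 0)
   /\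
   (forall i : 'I_l2,
      \sum_(s < n) dual_form B (La s) (simple_root 1) / (t2 i - z s)
      - \sum_(j < l2 | j != i) 2 / (t2 i - t2 j)
      + \sum_(j < l1) 1 / (t2 i - t1 j) = 0))
  <->
  exists mu : 'I_n -> R[i],
    \sum_(s < n) mu s = 0 /\
    forall x : R[i], (forall s, x <> z s) ->
      (P1^`()^`()).[x] * P2.[x] - (P1^`()).[x] * (P2^`()).[x]
      + P1.[x] * (P2^`()^`()).[x]
      - (P1^`()).[x] * P2.[x]
        * (\sum_(s < n) dual_form B (La s) (simple_root 0) / (x - z s))
      - P1.[x] * (P2^`()).[x]
        * (\sum_(s < n) dual_form B (La s) (simple_root 1) / (x - z s))
      + P1.[x] * P2.[x]
        * (\sum_(s < n) 1 / (x - z s)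
             * (mu s - \sum_(k < n | k != s)
                         dual_form B (La s) (La k) / (z s - z k))) = 0.
Proof.
(* Unification takes [a] and [b] to be the pairings of the weights with the two simple roots. *)
apply: (@bethe_iff_operator _ n l1 l2 z _ _ t1 t2 t1_inj t2_inj _ _ _
          (fun s k => dual_form B (La s) (La k))).
- by move=> i j; apply/eqP; exact: t1_t2.
- by move=> s i; apply/eqP; exact: z_t1.
- by move=> s i; apply/eqP; exact: z_t2.
- by move=> s k; exact: dual_form_sym.
Qed.
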